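(* Let $m\ge 2$, $n\ge1$, and let $\mathcal T\in\mathbb T(\mathbb C^n,m)$ be generic. Then $$\operatorname{am}(\lambda)=\operatorname{gm}(\lambda)=1\quad\text{for all }\lambda\in\sigma(\mathcal T).$$
   Context: $\mathbb T(\mathbb C^n,m)=\otimes^m\mathbb C^n$ is the space of $m$-th order $n$-dimensional complex tensors $\mathcal T=(t_{i_1\ldots i_m})$. ''Generic'' means that the assertion holds for all $\mathcal T$ in some nonempty Zariski open subset of $\mathbb T(\mathbb C^n,m)$. For $\mathbf x\in\mathbb C^n$, $\mathcal T\mathbf x^{m-1}\in\mathbb C^n$ has $i$-th entry $\sum_{i_2,\dots,i_m=1}^n t_{ii_2\ldots i_m}x_{i_2}\cdots x_{i_m}$, and $\mathbf x^{[m-1]}$ has $i$-th entry $x_i^{m-1}$. The identity tensor $\mathcal I$ has entries $1$ when $i_1=\dots=i_m$ and $0$ otherwise. A number $\lambda\in\mathbb C$ is an eigenvalue of $\mathcal T$ if there is $\mathbf x\neq\mathbf 0$ with $\mathcal T\mathbf x^{m-1}=\lambda\mathbf x^{[m-1]}$; $\sigma(\mathcal T)$ is the set of eigenvalues. The eigenvariety is $V(\lambda)=\{\mathbf x\in\mathbb C^n:\mathcal T\mathbf x^{m-1}=\lambda\mathbf x^{[m-1]}\}$ (with $\mathbf 0$ included), an affine variety in $\mathbb C^n$. The determinant $\operatorname{Det}(\mathcal T)$ is the classical resultant of the $n$ homogeneous polynomials $(\mathcal T\mathbf x^{m-1})_i$, $i=1,\dots,n$, of degree $m-1$ in $n$ variables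 (the irreducible integer polynomial in the coefficients vanishing if and only if the system has a nontrivial common zero in $\mathbb C^n$, normalized to be $1$ at $(x_1^{m-1},\dots,x_n^{m-1})$). The characteristic polynomial is $\chi(\lambda)=\operatorname{Det}(\lambda\mathcal I-\mathcal T)$, monic of degree $n(m-1)^{n-1}$, whose roots are exactly the eigenvalues. $\operatorname{am}(\lambda)$ is the multiplicity of $\lambda$ as a root of $\chi$, and $\operatorname{gm}(\lambda)=\dim V(\lambda)$ as an affine variety in $\mathbb C^n$. *)

(* Defs.v *)
From HB Require Import structures.
From mathcomp Require Import all_boot all_order all_algebra.
From mathcomp Require Import complex.
From mathcomp Require Import boolp classical_sets reals.
From mathcomp Require Import mpoly.

Set Implicit Arguments.
Unset Strict Implicit.
Unset Printing Implicit Defensive.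

Import GRing.Theory.
Local Open Scope classical_set_scope.
Local Open Scope ring_scope.

Section AffineSpace.
Variables (K : fieldType) (k : nat).
Implicit Types V Z A B : set 'rV[K]_k.

Definition zero_locus (S : set {mpoly K[k]}) : set 'rV[K]_k :=
  [set x | forall p, S p -> p.@[x 0] = 0].

Definition zariski_closed Z := exists S, Z = zero_locus S.

Definition zariski_open Z := zariski_closed (~` Z).

Definition irreducible_closed Z :=
  [/\ zariski_closed Z, Z !=set0 &
      forall A B, zariski_closed A -> zariski_closed B ->
        Z `<=` A `|` B -> Z `<=` A \/ Z `<=` B].

(* F 0, ..., F d are the members of the chain; later values are irrelevant. *)
Definition irreducible_chain V (d : nat) (F : nat -> set 'rV[K]_k) :=
  (forall i, (i <= d)%N -> irreducible_closed (F i) /\ F i `<=` V) /\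
  (forall i, (i < d)%N -> F i `<` F i.+1).

Definition is_dim V (d : nat) :=
  (exists F, irreducible_chain V d F) /\
  (forall e, (exists F, irreducible_chain V e F) -> (e <= d)%N).

(* Meant for Zariski closed V, whose closed subsets in the induced topology
   are the closed subsets of the affine space contained in V. The default
   value 0 is only reached when V is empty. *)
Definition affine_dim V : nat := xget 0%N [set d | is_dim V d].

End AffineSpace.

Definition irreducible_elt (A : idomainType) (p : A) :=
  [/\ p != 0, p \isn't a GRing.unit &
      forall q r, p = q * r -> q \is a GRing.unit \/ r \is a GRing.unit].

(* The pair (i, a) indexes the coefficient of 'X_[a] in the i-th of n forms of
   degree d in n variables. *)
Definition coef_index (n d : nat) : finType :=
  ('I_n * {a : 'X_{1..n < d.+1} | mdeg a == d})%type.

Section Resultant.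
Variables (n d : nat).

Definition form_coef (K : nzRingType) (f : 'I_n -> {mpoly K[n]})
    (c : coef_index n d) : K :=
  (f c.1)@_(val (val c.2)).

Definition eval_at_forms (K : comNzRingType)
    (Res : {mpoly int[#|coef_index n d|]}) (f : 'I_n -> {mpoly K[n]}) : K :=
  mmap (intr : int -> K) (fun k => form_coef f (enum_val k)) Res.

Definition is_resultant (C : fieldType)
    (Res : {mpoly int[#|coef_index n d|]}) :=
  [/\ irreducible_elt Res,
      forall f : 'I_n -> {mpoly C[n]}, (forall i, f i \is d.-homog) ->
        eval_at_forms Res f = 0 <->
        exists2 x : 'rV[C]_n, x != 0 & forall i, (f i).@[x 0] = 0 &
      eval_at_forms Res (fun i => 'X_i ^+ d : {mpoly int[n]}) = 1].

End Resultant.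

Definition tensor (K : Type) (n m : nat) := {ffun m.-tuple 'I_n -> K}.

Section Tensor.
Variables (K : comNzRingType) (n m : nat).
Implicit Types (T : tensor K n m) (x : 'rV[K]_n).

(* T x^{m-1}: the i-th entry sums over the multi-indices (i, i_2, ..., i_m). *)
Definition tensor_apply T x : 'rV[K]_n :=
  \row_i \sum_(J : m.-tuple 'I_n | ohead J == Some i)
            T J * \prod_(j <- behead J) x 0 j.

Definition hadamard_exp x (e : nat) : 'rV[K]_n := \row_i x 0 i ^+ e.

Definition identity_tensor : tensor K n m := [ffun J : m.-tuple 'I_n => (constant J)%:R].

Definition tensor_form T (i : 'I_n) : {mpoly K[n]} :=
  \sum_(J : m.-tuple 'I_n | ohead J == Some i)
     T J *: \prod_(j <- behead J) 'X_j.

Lemma tensor_formE T i x : (tensor_form T i).@[x 0] = tensor_apply T x 0 i.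
Proof.
rewrite mxE raddf_sum /=; apply: eq_bigr => J _.
by rewrite mevalZ rmorph_prod; congr (_ * _); apply: eq_bigr => j _ /=; rewrite mevalXU.
Qed.

Lemma tensor_form_homog T i : tensor_form T i \is m.-1.-homog.
Proof.
apply: rpred_sum => J _; apply: rpredZ.
have -> : m.-1 = size (behead J) by rewrite size_behead size_tuple.
elim: (behead J) => [|j s IHs]; first by rewrite big_nil dhomog1.
rewrite big_cons [size _]/= -add1n. by apply: dhomogM => //; rewrite dhomogX /= mdeg1.
Qed.

Definition Det (Res : {mpoly int[#|coef_index n m.-1|]}) T : K :=
  eval_at_forms Res (tensor_form T).

End Tensor.

Section Eigen.
Variables (C : fieldType) (n m : nat).
Implicit Types (T : tensor C n m) (lambda : C).

Definition eigenvariety T lambda : set 'rV[C]_n :=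
  [set x | tensor_apply T x = lambda *: hadamard_exp x m.-1].

Definition eigenvalue_of T lambda :=
  exists2 x : 'rV[C]_n, x != 0 &
    tensor_apply T x = lambda *: hadamard_exp x m.-1.

Definition spectrum T : set C := [set lambda | eigenvalue_of T lambda].

Definition char_tensor T : tensor {poly C} n m :=
  [ffun J => 'X * identity_tensor {poly C} n m J - (T J)%:P].

(* Det is evaluated over {poly C}, the polynomials in lambda. *)
Definition tensor_charpoly (Res : {mpoly int[#|coef_index n m.-1|]}) T
  : {poly C} := Det Res (char_tensor T).

Definition alg_mult Res T lambda : nat := mup lambda (tensor_charpoly Res T).

Definition geom_mult T lambda : nat := affine_dim (eigenvariety T lambda).

Definition tensor_coords T : 'rV[C]_(#|{: m.-tuple 'I_n}|) :=
  \row_k T (enum_val k).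

Definition generically (P : tensor C n m -> Prop) :=
  exists U : set 'rV[C]_(#|{: m.-tuple 'I_n}|),
    [/\ zariski_open U, U !=set0 & forall T, U (tensor_coords T) -> P T].

End Eigen.

(* Main.v *)
(** Simplicity of the eigenvalues: by Gauss' lemma [Res] is a prime element of
    Z[c], and c |-> X iota - c (iota the coefficients of the identity tensor)
    extends to an automorphism of Z[c][X], so the characteristic polynomial P of
    the generic tensor is prime in Z[c][X].  It is therefore coprime to P' over the
    fraction field of Z[c], and clearing denominators gives u P + v P' = a with a
    nonzero in Z[c]; where a does not vanish, all roots are simple.

    Uniqueness of the eigenvector: [Res] vanishes on the linear space of systems
    having x as a solution.  If f = lambda I - T had two independent solutions x
    and y, the corresponding two spaces would together span all systems, so [Res]
    would be singular at f and lambda would be a multiple root.  Hence for a simple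
    eigenvalue the eigenvariety is a line. *)
From HB Require Import structures.
Require Import Defs.
From mathcomp Require Import all_boot all_order all_algebra.
From mathcomp Require Import complex.
From mathcomp Require Import boolp classical_sets reals.
From mathcomp Require Import mpoly.
From mathcomp Require Import zify ring.

Set Implicit Arguments.
Unset Strict Implicit.
Unset Printing Implicit Defensive.

Import Order.TTheory GRing.Theory Num.Theory.
Local Open Scope classical_set_scope.
Local Open Scope ring_scope.

(** * Factorial rings *)

Definition divides (A : comNzRingType) (a b : A) := exists c, b = a * c.

Definition prime_elt (A : idomainType) (p : A) :=
  [/\ p != 0, p \isn't a GRing.unit &
      forall a b, divides p (a * b) -> divides p a \/ divides p b].

Definition prime_factored (A : idomainType) (a : A) := exists u (s : seq A),
  [/\ u \is a GRing.unit, forall p, p \in s -> prime_elt p & a = u * \prod_(p <- s) p].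

(** Factoring into primes rather than irreducibles makes uniqueness automatic, so only existence is
    asked. *)
Definition factorial_ring (A : idomainType) := forall a : A, a != 0 -> prime_factored a.

Lemma divides_sum (A : comNzRingType) (p : A) (I : Type) (r : seq I) (P : pred I) (F : I -> A) :
  (forall i, P i -> divides p (F i)) -> divides p (\sum_(i <- r | P i) F i).
Proof.
move=> H; elim/big_ind: _ => //; first by exists 0; rewrite mulr0.
by move=> x y [c ->] [d ->]; exists (c + d); rewrite mulrDr.
Qed.

Lemma prime_elt_mulr (A : idomainType) (u p : A) :
  u \is a GRing.unit -> prime_elt p -> prime_elt (p * u).
Proof.
move=> uU [p0 pU pP]; split.
- by rewrite mulf_neq0 //; apply: contraTneq uU => ->; rewrite unitr0.
- by rewrite unitrMl.
move=> a b [c e].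
have [|[d ->]|[d ->]] := pP a b; first by exists (u * c); rewrite e mulrA.
  by left; exists (u^-1 * d); rewrite -mulrA mulVKr.
by right; exists (u^-1 * d); rewrite -mulrA mulVKr.
Qed.

(** Some prime splits off from the non-unit [a]; by irreducibility the cofactor is a unit, so [a] is
    associated to that prime. *)
Lemma irreducible_prime (A : idomainType) (a : A) :
  factorial_ring A -> irreducible_elt a -> prime_elt a.
Proof.
move=> fA [a0 aU aI].
have [u [[|p s] [uU sP e]]] := fA a a0.
  by move: aU; rewrite e big_nil mulr1 uU.
have pp : prime_elt p by apply: sP; rewrite mem_head.
have [_ pU _] := pp.
move: e; rewrite big_cons mulrCA => e.
have [] := aI _ _ e; first by rewrite (negPf pU).
by rewrite e => /prime_elt_mulr; apply.
Qed.

Lemma prime_elt_iso (A B : idomainType) (f : {rmorphism A -> B}) (g : {rmorphism B -> A})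
    (p : A) : cancel f g -> cancel g f -> prime_elt p -> prime_elt (f p).
Proof.
move=> fK gK [p0 pU pP]; split; first by rewrite -(rmorph0 f) (can_eq fK).
  by apply: contra pU => /(rmorph_unit g); rewrite fK.
move=> x y [c exy]; have [|[d ex]|[d ey]] := pP (g x) (g y).
- by exists (g c); rewrite -rmorphM exy rmorphM fK.
- by left; exists (f d); rewrite -rmorphM -ex gK.
- by right; exists (f d); rewrite -rmorphM -ey gK.
Qed.

Lemma factorial_ring_iso (A B : idomainType) (f : {rmorphism A -> B}) (g : {rmorphism B -> A}) :
  cancel f g -> cancel g f -> factorial_ring A -> factorial_ring B.
Proof.
move=> fK gK fA b b0.
have [|u [s [uU sP e]]] := fA (g b); first by rewrite -(rmorph0 g) (can_eq gK).
exists (f u), [seq f p | p <- s]; split.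
- exact: rmorph_unit.
- by move=> _ /mapP[p /sP pp ->]; apply: (prime_elt_iso fK gK pp).
- by rewrite big_map -rmorph_prod -rmorphM -e gK.
Qed.

Lemma prime_dvd_prod (A : idomainType) (p : A) (s : seq A) :
  prime_elt p -> divides p (\prod_(q <- s) q) -> exists2 q, q \in s & divides p q.
Proof.
move=> [p0 pU pP]; elim: s => [|q s IH]; rewrite ?big_nil ?big_cons.
  by move=> [c e]; case/negP: pU; apply/unitrPr; exists c.
move=> /pP[pq|/IH[r rs pr]]; first by exists q; rewrite ?mem_head.
by exists r; rewrite ?inE ?rs ?orbT.
Qed.

Lemma prime_dvd_prime (A : idomainType) (p q : A) :
  prime_elt p -> prime_elt q -> divides p q -> exists2 u, u \is a GRing.unit & q = p * u.
Proof.
move=> [p0 pU pP] [q0 qU qP] [c e].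
have [|[d ep]|[d ec]] := qP p c; first by exists 1; rewrite mulr1.
  exists c => //; apply/unitrPr; exists d.
  by apply: (mulfI q0); rewrite mulr1 [in RHS]e {1}ep; ring.
case/negP: pU; apply/unitrPr; exists d; apply: (mulfI q0).
by rewrite mulr1 [in RHS]e ec; ring.
Qed.

(** * Gauss' lemma and primitive polynomials *)

Lemma divides_polyC (A : idomainType) (p : A) (f : {poly A}) :
  divides p%:P f <-> forall i, divides p f`_i.
Proof.
split=> [[g ->] i|H]; first by exists g`_i; rewrite coefCM.
have [c cP] := choice H.
exists (\poly_(i < size f) c i); apply/polyP => i.
rewrite coefCM coef_poly; case: ltnP => [_|/(nth_default 0) ->]; last by rewrite mulr0.
exact: cP.
Qed.

(** If [p] divides neither factor, take the first coefficients f_i and g_j that it does not divide.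
    In the coefficient of index i + j of the product every other term is divisible by [p], hence so
    is f_i g_j. *)
Lemma prime_polyC (A : idomainType) (p : A) : prime_elt p -> prime_elt p%:P.
Proof.
move=> [p0 pU pP]; split; first by rewrite polyC_eq0.
  by rewrite poly_unitE coefC eqxx (negPf pU) andbF.
move=> f g /divides_polyC fgP; apply: contrapT => /not_orP[nf ng].
have minP (h : {poly A}) : ~ divides p%:P h ->
    exists i, ~ divides p h`_i /\ forall j, (j < i)%N -> divides p h`_j.
  move=> nh; have /existsNP[i0 i0P] : ~ forall i, divides p h`_i.
    by move=> /divides_polyC.
  have ex : exists i, `[< ~ divides p h`_i >] by exists i0; apply/asboolP.
  case: (ex_minnP ex) => i /asboolP iP imin; exists i; split => // j ji.
  apply: contrapT => jP; move: (imin j); rewrite leqNgt ji => /(_ _)/negP; apply => //.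
  exact/asboolP.
have [i [iP imin]] := minP f nf; have [j [jP jmin]] := minP g ng.
have [c] := fgP (i + j)%N.
have ij : (i < (i + j).+1)%N by rewrite ltnS leq_addr.
rewrite coefM (bigD1 (Ordinal ij)) //= addKn.
set S := (X in _ + X = _) => e.
have [d Sd] : divides p S.
  apply: divides_sum => k ki.
  have [ltk|ltk] : (k < i)%N \/ (i + j - k < j)%N.
    have : (k : nat) != i by [].
    by have := ltn_ord k; lia.
  - by have [d ->] := imin k ltk; exists (d * g`_(i + j - k)); rewrite mulrA.
  - by have [d ->] := jmin _ ltk; exists (f`_k * d); rewrite mulrCA.
by case: (pP f`_i g`_j) => //; exists (c - d); rewrite mulrBr -e Sd addrK.
Qed.

Definition primitive (A : idomainType) (f : {poly A}) :=
  forall p, prime_elt p -> ~ divides p%:P f.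

(** Divisibility by a primitive [f] descends from the fraction field: each prime of [c] divides f g
    but not [f], so it can be cancelled from [g]. *)
Lemma primitive_cancel (A : idomainType) (f g h : {poly A}) (c : A) :
  factorial_ring A -> primitive f -> c != 0 -> c%:P * h = f * g -> divides f h.
Proof.
move=> fA fP c0; have [u [s [uU sP ->]]] := fA c c0.
elim: s h g sP => [|p s IH] h g sP.
  rewrite big_nil mulr1 => e; exists (u^-1%:P * g).
  by rewrite mulrCA -e mulrA -polyCM mulVr // mul1r.
rewrite big_cons => e.
have pp : prime_elt p by apply: sP; rewrite mem_head.
have [p0 _ pP] := prime_polyC pp.
have [|/fP//|[g' eg]] := pP f g.
  by rewrite -e; exists ((u * \prod_(j <- s) j)%:P * h); rewrite mulrCA !polyCM -mulrA.
apply: (IH h g') => [q qs|]; first by apply: sP; rewrite inE qs orbT.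
by apply: (mulfI p0); rewrite mulrA -polyCM mulrCA e eg mulrCA.
Qed.

(** Each prime of [c] divides [g] or [h] and is cancelled there, which leaves the degrees
    unchanged. *)
Lemma clear_denominators (A : idomainType) (f g h : {poly A}) (c : A) :
  factorial_ring A -> c != 0 -> c%:P * f = g * h ->
  exists g' h', [/\ f = g' * h', size g' = size g & size h' = size h].
Proof.
move=> fA c0; have [u [s [uU sP ->]]] := fA c c0.
have uI0 : u^-1 != 0 by apply: contraTneq uU => u0; rewrite -unitrV u0 unitr0.
elim: s g h sP => [|p s IH] g h sP.
  rewrite big_nil mulr1 => e; exists (u^-1 *: g), h; split => //.
    by rewrite -scalerAl -e -mul_polyC mulrA -polyCM mulVr // mul1r.
  by rewrite size_scale.
rewrite big_cons => e.
have pp : prime_elt p by apply: sP; rewrite mem_head.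
have p0 : p != 0 by case: pp.
have [pC0 _ pP] := prime_polyC pp.
have sP' q : q \in s -> prime_elt q by move=> qs; apply: sP; rewrite inE qs orbT.
have [|[g' eg]|[h' eh]] := pP g h.
- by rewrite -e; exists ((u * \prod_(j <- s) j)%:P * f); rewrite mulrCA !polyCM -mulrA.
- have [|g1 [h1 [ef sg sh]]] := IH g' h sP'.
    by apply: (mulfI pC0); rewrite mulrA -polyCM mulrCA e eg mulrA.
  by exists g1, h1; rewrite eg mul_polyC size_scale.
- have [|g1 [h1 [ef sg sh]]] := IH g h' sP'.
    by apply: (mulfI pC0); rewrite mulrA -polyCM mulrCA e eh mulrCA.
  by exists g1, h1; rewrite eh mul_polyC size_scale.
Qed.

(* Irreducibility over the fraction field of A, for f of positive degree. *)
Definition frac_irreducible (A : idomainType) (f : {poly A}) :=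
  forall c g h, c != 0 -> c%:P * f = g * h -> (size g <= 1)%N \/ (size h <= 1)%N.

(** * Bezout identities and primality over the fraction field *)

Lemma pseudo_division (A : idomainType) (f g : {poly A}) : g != 0 ->
  exists c q r, [/\ c != 0, c%:P * f = q * g + r & (size r < size g)%N].
Proof.
move=> g0; exists (lead_coef g ^+ scalp f g), (f %/ g), (f %% g); split.
- exact: Pdiv.Idomain.lc_expn_scalp_neq0.
- by rewrite mul_polyC Pdiv.Idomain.divp_eq.
- by rewrite ltn_modp.
Qed.

(** A variant of Euclid's algorithm in which [f] itself is divided by each successive remainder. A
    zero remainder would give a nonconstant factor of [f] of smaller degree, so the descent ends at
    a nonzero constant. *)
Lemma frac_irreducible_bezout (A : idomainType) (f g : {poly A}) :
  frac_irreducible f -> g != 0 -> (size g < size f)%N ->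
  exists a u v, a != 0 /\ u * f + v * g = a%:P.
Proof.
move=> fI; have [k] := ubnP (size g); elim: k g => // k IH g /ltnSE gk g0 gf.
have [g1|g1] := leqP (size g) 1.
  exists g`_0, 0, 1; rewrite mul0r add0r mul1r; split; last exact: size1_polyC.
  by apply: contra_neq g0 => e; rewrite (size1_polyC g1) e.
have [c [q [r [c0 e rg]]]] := pseudo_division f g0.
have [r0|r0] := eqVneq r 0.
  move: e; rewrite r0 addr0 => e.
  have [q1|] := fI _ _ _ c0 e; last by rewrite leqNgt g1.
  have : size (c%:P * f) = size (q * g) by rewrite e.
  rewrite mul_polyC size_scale // (size1_polyC q1) mul_polyC => ef.
  by have := size_scale_leq q`_0 g; lia.
have [|||a [u [v [a0 eq]]]] := IH r => //; [lia..|].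
exists a, (u + v * c%:P), (- (v * q)); split => //; rewrite -eq.
by rewrite mulrDl -mulrA e; ring.
Qed.

Lemma frac_irreducible_prime (A : idomainType) (f : {poly A}) :
  factorial_ring A -> (1 < size f)%N -> primitive f -> frac_irreducible f ->
  prime_elt f.
Proof.
move=> fA f1 fP fI.
have f0 : f != 0 by rewrite -size_poly_gt0; lia.
split => //; first by rewrite poly_unitE; case: eqP f1 => // ->.
move=> g h [w e].
have [c [q [r [c0 eg rf]]]] := pseudo_division g f0.
have [r0|r0] := eqVneq r 0.
  by left; apply: (primitive_cancel (g := q) fA fP c0); rewrite eg r0 addr0 mulrC.
have [a [u [v [a0 ea]]]] := frac_irreducible_bezout fI r0 rf.
(* The cofactor comes from multiplying u f + v r = a by [h] and inserting r = c g - q f and g h = f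
   w. *)
right; apply: (primitive_cancel (g := u * h + v * c%:P * w - v * q * h) fA fP a0).
rewrite -ea; have -> : r = c%:P * g - q * f by rewrite eg addrC addKr.
transitivity (f * u * h + v * c%:P * (g * h) - v * q * f * h); first by ring.
by rewrite e; ring.
Qed.

(** A prime [f] divides [g] or [h]; that factor has at least the degree of [f], so the other is
    constant. *)
Lemma prime_frac_irreducible (A : idomainType) (f : {poly A}) :
  prime_elt f -> frac_irreducible f.
Proof.
move=> [f0 fU fP] c g h c0 e.
have szM : (size f = (size g + size h).-1)%N.
  rewrite -size_mul -?e ?mul_polyC ?size_scale //;
  by apply: contra_neq f0 => z; move: e; rewrite z ?mul0r ?mulr0 => /eqP;
    rewrite mulf_eq0 polyC_eq0 (negPf c0) /= => /eqP.
have := size_poly_gt0 f; rewrite f0 => s0.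
have cf0 : g * h != 0 by rewrite -e mulf_neq0 ?polyC_eq0.
move: cf0; rewrite mulf_eq0 negb_or => /andP[g0 h0].
have le (k : {poly A}) : k != 0 -> divides f k -> (size f <= size k)%N.
  move=> k0 [w ew]; rewrite ew size_mul //; last first.
    by apply: contra_neq k0 => w0; rewrite ew w0 mulr0.
  suff : (0 < size w)%N by case: (size w) => // j _; rewrite addnS leq_addr.
  by rewrite size_poly_gt0; apply: contra_neq k0 => w0; rewrite ew w0 mulr0.
have [|/(le _ g0)|/(le _ h0)] := fP g h; first by exists c%:P; rewrite -e mulrC.
  by move=> ?; right; lia.
by move=> ?; left; lia.
Qed.

(** * Unique factorization in polynomial rings *)

(** Induction on the number of primes in the leading coefficient: a prime dividing [f] is associated
    to one of them, and dividing [f] by it uses that one up. *)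
Lemma content_primitive (A : idomainType) (f : {poly A}) :
  factorial_ring A -> f != 0 ->
  exists c g, [/\ c != 0, f = c%:P * g & primitive g].
Proof.
move=> fA f0.
have [|u [s [uU sP lf]]] := fA (lead_coef f); first by rewrite lead_coef_eq0.
have [k] := ubnP (size s); elim: k f f0 u s uU sP lf => // k IH f f0 u s uU sP lf /ltnSE sk.
have [fP|] := pselect (primitive f); first by exists 1, f; rewrite oner_neq0 mul1r.
move=> /existsNP[p /not_implyP[pp /contrapT[g eg]]].
have p0 : p != 0 by case: pp.
have [_ pU pP] := pp.
have eu : divides p (u * \prod_(q <- s) q).
  by rewrite -lf eg lead_coefM lead_coefC; exists (lead_coef g).
have [q qs pq] : exists2 q, q \in s & divides p q.
  apply: prime_dvd_prod => //; have [[d eu']|//] := pP _ _ eu.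
  case/negP: pU; apply/unitrPr; exists (d / u).
  by rewrite mulrA -eu' divrr.
have [v vU eq] := prime_dvd_prime pp (sP _ qs) pq.
have g0 : g != 0 by apply: contra_neq f0 => g0; rewrite eg g0 mulr0.
have [|r rs|||c [h [c0 eh hP]]] := IH g g0 (u * v) (rem q s).
- by rewrite unitrMl.
- by apply: sP; apply: mem_rem rs.
- apply: (mulfI p0); have := lf.
  rewrite eg lead_coefM lead_coefC (perm_big _ (perm_to_rem qs)) /= big_cons => ->.
  by rewrite eq; ring.
- by rewrite size_rem //; case: (s) qs sk.
exists (p * c), h; split => //; first by rewrite mulf_neq0.
by rewrite eg eh polyCM mulrA.
Qed.

Lemma prime_factored_mul (A : idomainType) (a b : A) :
  prime_factored a -> prime_factored b -> prime_factored (a * b).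
Proof.
move=> [u [s [uU sP ->]]] [v [t [vU tP ->]]].
exists (u * v), (s ++ t); split; first by rewrite unitrMl.
- by move=> p; rewrite mem_cat => /orP[/sP|/tP].
- by rewrite big_cat /=; ring.
Qed.

Lemma prime_factored_polyC (A : idomainType) (c : A) :
  prime_factored c -> prime_factored c%:P.
Proof.
move=> [u [s [uU sP ->]]]; exists u%:P, (map polyC s); split.
- by rewrite rmorph_unit.
- by move=> _ /mapP[p /sP/prime_polyC ? ->].
- by rewrite polyCM rmorph_prod big_map.
Qed.

(** After the content is split off, induction on the degree of the primitive part: it is constant,
    or irreducible over the fraction field and so prime, or splits after clearing denominators into
    two factors of smaller degree, again primitive. *)
Lemma factorial_poly (A : idomainType) : factorial_ring A -> factorial_ring {poly A}.
Proof.
move=> fA f f0; have [c [g [c0 ef gP]]] := content_primitive fA f0.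
have g0 : g != 0 by apply: contra_neq f0 => g0; rewrite ef g0 mulr0.
rewrite ef; apply: prime_factored_mul; first exact/prime_factored_polyC/fA.
have [k] := ubnP (size g); elim: k g g0 gP {ef} => // k IH g g0 gP /ltnSE gk.
have [g1|g1] := leqP (size g) 1.
  rewrite (size1_polyC g1); apply/prime_factored_polyC/fA.
  by apply: contra_neq g0 => e; rewrite (size1_polyC g1) e.
have [gI|] := pselect (frac_irreducible g).
  exists 1, [:: g]; split; rewrite ?unitr1 ?big_seq1 ?mul1r // => p.
  by rewrite inE => /eqP ->; apply: frac_irreducible_prime.
move=> /existsNP[d /existsNP[a /existsNP[b /not_implyP[d0 /not_implyP[e]]]]].
move=> /not_orP[/negP + /negP]; rewrite -!ltnNge.
have [a' [b' [eg <- <-]]] := clear_denominators fA d0 e.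
have [a0 b0] : a' != 0 /\ b' != 0.
  by apply/andP; rewrite -negb_or -mulf_eq0 -eg.
move=> a1 b1; have sz : size g = (size a' + size b').-1 by rewrite eg size_mul.
rewrite eg; apply: prime_factored_mul; apply: IH => //; try lia.
- move=> p pp [q eq]; apply: (gP p pp); exists (q * b').
  by rewrite eg eq mulrA.
- move=> p pp [q eq]; apply: (gP p pp); exists (q * a').
  by rewrite eg eq mulrCA [q * a']mulrC.
Qed.

Lemma factorial_int : factorial_ring int.
Proof.
move=> a; have [k] := ubnP `|a|%N; elim: k a => // k IH a /ltnSE ak a0.
have [a1|a1] := eqVneq `|a|%N 1%N.
  exists a, [::]; rewrite big_nil mulr1; split => //.
  by apply/unitrPr; exists a; lia.
have pp := pdiv_prime (n := `|a|%N) ltac:(lia).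
set p := pdiv _ in pp.
have pa : (p%:Z %| a)%Z by rewrite dvdzE pdiv_dvd.
have := divzK pa; set b := (a %/ p)%Z => eb.
have p1 := prime_gt1 pp.
rewrite -eb; apply: prime_factored_mul.
  by apply: IH; [nia | apply: contra_neq a0 => b0; rewrite -eb b0 mul0r].
exists 1, [:: p%:Z]; split; rewrite ?unitr1 ?big_seq1 ?mul1r // => q.
rewrite inE => /eqP ->; split; first by lia.
  by apply/unitrPr => -[d] /(congr1 absz) /eqP; rewrite abszM muln_eq1 /=; lia.
move=> x y [c e]; have : (p%:Z %| x * y)%Z by rewrite e dvdz_mulr.
rewrite dvdzE abszM Euclid_dvdM // => /orP[] H; [left|right].
  by have : (p%:Z %| x)%Z by [rewrite dvdzE]; move=> /dvdzP[d ->]; exists d; rewrite mulrC.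
by have : (p%:Z %| y)%Z by [rewrite dvdzE]; move=> /dvdzP[d ->]; exists d; rewrite mulrC.
Qed.

(** * Polynomials with integer coefficients *)

(** Integers have a forced image in any ring. This reduces every later identity between
    substitutions to a check on the variables. *)
Lemma mpoly_int_rmorph_eq (n : nat) (K : comNzRingType)
    (f g : {rmorphism {mpoly int[n]} -> K}) :
  (forall i, f 'X_i = g 'X_i) -> f =1 g.
Proof.
move=> fg p; rewrite [p]mpolyE !rmorph_sum; apply: eq_bigr => m _.
rewrite -mul_mpolyC !rmorphM -[X in X%:MP]intz !rmorph_int.
rewrite mpolyXE_id !rmorph_prod; congr (_ * _); apply: eq_bigr => i _.
by rewrite !rmorphXn /= fg.
Qed.

Lemma poly_rmorph_eq (A K : comNzRingType) (f g : {rmorphism {poly A} -> K}) :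
  f 'X = g 'X -> (forall c, f c%:P = g c%:P) -> f =1 g.
Proof.
move=> fgX fgC p; rewrite -[p]coefK poly_def !rmorph_sum; apply: eq_bigr => i _.
by rewrite -mul_polyC !rmorphM !rmorphXn fgX fgC.
Qed.

Lemma mmap_intX (n : nat) (K : comNzRingType) (v : 'I_n -> K) i :
  mmap (intr : int -> K) v 'X_i = v i.
Proof. by rewrite mmapX mmap1U. Qed.

Lemma mmap_int_comp (n : nat) (K L : comNzRingType) (f : {rmorphism K -> L})
    (v : 'I_n -> K) (w : 'I_n -> L) (p : {mpoly int[n]}) :
  (forall i, f (v i) = w i) ->
  f (mmap (intr : int -> K) v p) = mmap (intr : int -> L) w p.
Proof.
move=> fv; pose g : {rmorphism {mpoly int[n]} -> L} := f \o mmap (intr : int -> K) v.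
by apply: (mpoly_int_rmorph_eq (f := g)) => i /=; rewrite !mmap_intX.
Qed.

(** With [poly_to_mpoly], the isomorphism that singles out the variable of index 0, for inductions
    on the number of variables. *)
Definition mpoly_to_poly (n : nat) : {mpoly int[n.+1]} -> {poly {mpoly int[n]}} :=
  mmap (intr : int -> {poly {mpoly int[n]}})
    (fun i => if unlift ord0 i is Some j then ('X_j)%:P else 'X).
HB.instance Definition _ n := GRing.RMorphism.on (@mpoly_to_poly n).

Definition poly_to_mpoly (n : nat) : {poly {mpoly int[n]}} -> {mpoly int[n.+1]} :=
  horner_eval ('X_ord0) \o
    map_poly (mmap (intr : int -> {mpoly int[n.+1]}) (fun j => 'X_(lift ord0 j))).
HB.instance Definition _ n := GRing.RMorphism.on (@poly_to_mpoly n).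

Lemma mpoly_to_polyK n : cancel (@mpoly_to_poly n) (@poly_to_mpoly n).
Proof.
apply: (mpoly_int_rmorph_eq (f := @poly_to_mpoly n \o @mpoly_to_poly n) (g := idfun)).
move=> i /=; rewrite /mpoly_to_poly mmap_intX /poly_to_mpoly /=.
case: unliftP => [j|] ->; rewrite ?map_polyC ?map_polyX /horner_eval ?hornerC ?hornerX //=.
by rewrite mmap_intX.
Qed.

Lemma poly_to_mpolyK n : cancel (@poly_to_mpoly n) (@mpoly_to_poly n).
Proof.
apply: (poly_rmorph_eq (f := @mpoly_to_poly n \o @poly_to_mpoly n) (g := idfun)) => /=.
  rewrite /poly_to_mpoly /= map_polyX /horner_eval hornerX.
  by rewrite /mpoly_to_poly mmap_intX unlift_none.
apply: (mpoly_int_rmorph_eq (f := @mpoly_to_poly n \o @poly_to_mpoly n \o polyC) (g := polyC)).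
move=> i /=; rewrite /poly_to_mpoly /= map_polyC /horner_eval hornerC /= mmap_intX.
by rewrite /mpoly_to_poly mmap_intX liftK.
Qed.

Lemma factorial_mpoly_int n : factorial_ring {mpoly int[n]}.
Proof.
elim: n => [|n IH].
  pose f : {rmorphism int -> {mpoly int[0]}} := intr.
  pose g : {rmorphism {mpoly int[0]} -> int} := mmap (intr : int -> int) (fun _ => 0).
  apply: (factorial_ring_iso (f := f) (g := g)); last exact: factorial_int.
    by move=> x; rewrite rmorph_int intz.
  by apply: (mpoly_int_rmorph_eq (f := f \o g) (g := idfun)) => -[].
exact: (factorial_ring_iso (@poly_to_mpolyK n) (@mpoly_to_polyK n) (factorial_poly IH)).
Qed.

(** * Points where a nonzero polynomial does not vanish *)

Lemma poly_eval0 (K : numDomainType) (p : {poly K}) : (forall x, p.[x] = 0) -> p = 0.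
Proof.
move=> p0; apply: contrapT => /eqP pn0.
suff : (size [seq i%:R : K | i <- iota 0 (size p)] < size p)%N.
  by rewrite size_map size_iota ltnn.
apply: max_poly_roots => //; first by apply/allP => x _; apply/eqP.
by rewrite map_inj_uniq ?iota_uniq // => i j /eqP; rewrite eqr_nat => /eqP.
Qed.

(** Induction: choose the other variables so that the leading coefficient in the variable of index 0
    survives, then a non-root of the resulting univariate polynomial. *)
Lemma mpoly_int_nonroot (K : numDomainType) n (p : {mpoly int[n]}) : p != 0 ->
  exists v : 'I_n -> K, mmap (intr : int -> K) v p != 0.
Proof.
elim: n p => [|n IH] p p0.
  exists (fun _ => 0); apply: contra_neq p0 => e.
  pose g : {rmorphism {mpoly int[0]} -> int} := mmap (intr : int -> int) (fun _ => 0).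
  have gK : cancel g (intr : int -> {mpoly int[0]}).
    by apply: (mpoly_int_rmorph_eq (f := intr \o g) (g := idfun)) => -[].
  suff g0 : g p = 0 by rewrite -(gK p) g0.
  apply: (@intr_inj K); by rewrite (mmap_int_comp (w := fun _ => 0)).
have q0 : mpoly_to_poly p != 0.
  by rewrite -(rmorph0 (@mpoly_to_poly n)) (can_eq (@mpoly_to_polyK n)).
have [v v0] := IH (lead_coef (mpoly_to_poly p)) ltac:(by rewrite lead_coef_eq0).
have [x xP] : exists x, (map_poly (mmap (intr : int -> K) v) (mpoly_to_poly p)).[x] != 0.
  apply: contrapT => /forallNP H.
  have /polyP/(_ (size (mpoly_to_poly p)).-1) :
      map_poly (mmap (intr : int -> K) v) (mpoly_to_poly p) = 0.
    by apply: poly_eval0 => x; apply/eqP; apply: contrapT => /negP; apply: H.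
  by rewrite coef_map coef0 => /eqP; apply/negP.
exists (fun i => if unlift ord0 i is Some j then v j else x).
apply: contra_neq xP => <-.
pose f : {rmorphism {mpoly int[n.+1]} -> K} :=
  horner_eval x \o map_poly (mmap (intr : int -> K) v) \o @mpoly_to_poly n.
apply: (mpoly_int_rmorph_eq (f := f)) => i /=.
rewrite /mpoly_to_poly !mmap_intX; case: (unlift _ _) => [j|] /=.
  by rewrite map_polyC /horner_eval hornerC /= mmap_intX.
by rewrite map_polyX /horner_eval hornerX.
Qed.

(* The substitution c |-> X iota - c extends to an involution of A[X], A = Z[c]. *)
Lemma prime_pencil n (iota : 'I_n -> int) (p : {mpoly int[n]}) : prime_elt p ->
  prime_elt (mmap (intr : int -> {poly {mpoly int[n]}})
    (fun k => 'X * (iota k)%:~R - ('X_k)%:P) p).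
Proof.
move=> pp; set v := fun k => _.
pose A := {mpoly int[n]}.
pose f0 : {rmorphism A -> {poly A}} := mmap (intr : int -> {poly A}) v.
pose f : {rmorphism {poly A} -> {poly A}} := horner_eval 'X \o map_poly f0.
have fX : f 'X = 'X by rewrite /f /= map_polyX /horner_eval hornerX.
have fC c : f c%:P = f0 c by rewrite /f /= map_polyC /horner_eval hornerC.
have fK : cancel f f.
  apply: (poly_rmorph_eq (f := f \o f) (g := idfun)) => [|c].
    by rewrite -[LHS]/(f (f 'X)) !fX.
  apply: (mpoly_int_rmorph_eq (f := f \o f \o polyC) (g := polyC)) => k.
  have fv : f ('X_k)%:P = v k by rewrite fC; exact: mmap_intX.
  transitivity (f (v k)); first by rewrite -fv.
  by rewrite rmorphB rmorphM rmorph_int fX fv opprB addrC subrK.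
rewrite -[mmap _ _ _]/(f0 p) -fC.
exact: (prime_elt_iso fK fK (prime_polyC pp)).
Qed.

(** The element [a] plays the role of a discriminant: where it does not vanish, the specialized
    polynomial has no multiple root. *)
Lemma prime_deriv_bezout n (p : {poly {mpoly int[n]}}) :
  prime_elt p -> (1 < size p)%N ->
  exists a u v, a != 0 /\ u * p + v * p^`() = a%:P.
Proof.
move=> pp p1; have p0 : p != 0 by case: pp.
apply: frac_irreducible_bezout; last exact: lt_size_deriv.
  exact: prime_frac_irreducible.
(* The derivative is nonzero: its top coefficient is the degree of [p] times [lead_coef p], in
   characteristic 0. *)
apply/eqP => /polyP/(_ (size p).-2); rewrite coef_deriv coef0.
have -> : (size p).-2.+1 = (size p).-1 by lia.
rewrite -/(lead_coef p) -mulr_natr => /eqP; rewrite mulf_eq0 lead_coef_eq0 (negPf p0) /=.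
by rewrite -mpolyC_nat mpolyC_eq0 pnatr_eq0; case: (size p) p1 => [|[]].
Qed.

(** * The dimension of a line *)

Lemma line_pullback (K : comNzRingType) k (x : 'rV[K]_k) (p : {mpoly K[k]}) :
  exists q : {poly K}, forall s, q.[s] = p.@[(s *: x) 0].
Proof.
exists (mmap (polyC : K -> {poly K}) (fun i => (x 0 i) *: 'X) p) => s.
rewrite -[LHS]/(horner_eval s _) /mmap rmorph_sum mevalE; apply: eq_bigr => m _.
rewrite rmorphM /= /horner_eval hornerC; congr (_ * _).
rewrite /mmap1 -[LHS]/(horner_eval s _) rmorph_prod; apply: eq_bigr => i _.
by rewrite rmorphXn /= /horner_eval hornerZ hornerX mxE mulrC.
Qed.

Lemma zero_locus1_closed (K : fieldType) k (p : {mpoly K[k]}) :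
  zariski_closed [set x : 'rV[K]_k | p.@[x 0] = 0].
Proof.
exists [set p]; apply/seteqP; split=> x /=; first by move=> px _ ->.
by apply.
Qed.

Lemma irreducible_closed_prod (K : fieldType) k (Z : set 'rV[K]_k) (I : eqType)
    (s : seq I) (p : I -> {mpoly K[k]}) :
  irreducible_closed Z -> (forall x, Z x -> (\prod_(i <- s) p i).@[x 0] = 0) ->
  exists i, forall x, Z x -> (p i).@[x 0] = 0.
Proof.
move=> [_ [z Zz] ZI]; elim: s => [/(_ z Zz)|i s IH].
  by rewrite big_nil meval1 => /eqP; rewrite oner_eq0.
rewrite big_cons => H.
have [||y Zy|Zi|Zs] := ZI [set x | (p i).@[x 0] = 0] [set x | (\prod_(j <- s) p j).@[x 0] = 0].
- exact: zero_locus1_closed.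
- exact: zero_locus1_closed.
- by have /eqP := H y Zy; rewrite mevalM mulf_eq0 => /orP[]/eqP; [left|right].
- by exists i.
- exact: IH.
Qed.

(** If neither closed set contains the line, each has an equation that pulls back to a nonzero
    polynomial in the parameter, yet the product of the two pullbacks vanishes everywhere. *)
Lemma irreducible_line (K : numFieldType) k (x : 'rV[K]_k) :
  zariski_closed [set s *: x | s in [set: K]] ->
  irreducible_closed [set s *: x | s in [set: K]].
Proof.
move=> lC; split => //; first by exists (0 *: x), 0.
move=> A B [SA ->] [SB ->] AB; apply: contrapT => /not_orP[].
move=> /existsNP[a /not_implyP[[s _ <-] /existsNP[p /not_implyP[Ap ps]]]].
move=> /existsNP[b /not_implyP[[t _ <-] /existsNP[q /not_implyP[Bq qt]]]].
have [P PE] := line_pullback x p; have [Q QE] := line_pullback x q.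
have PQ0 : P * Q = 0.
  apply: poly_eval0 => u; rewrite hornerM PE QE.
  have [|/(_ p Ap)|/(_ q Bq)] := AB (u *: x); first by exists u.
    by move=> ->; rewrite mul0r.
  by move=> ->; rewrite mulr0.
move/eqP: PQ0; rewrite mulf_eq0 => /orP[]/eqP z.
  by apply: ps; rewrite -PE z horner0.
by apply: qt; rewrite -QE z horner0.
Qed.

(** Some equation of [F] pulls back to a nonzero polynomial in the parameter. It splits into linear
    factors, and by irreducibility a single one of them vanishes on [F]. *)
Lemma proper_irreducible_line (K : closedFieldType) k (x : 'rV[K]_k)
    (F : set 'rV[K]_k) :
  irreducible_closed F -> F `<` [set s *: x | s in [set: K]] ->
  exists y, F `<=` [set y].
Proof.
move=> FI [Fl nF].
have x0 : x != 0.
  apply/eqP => x0; apply: nF => _ [s _ <-]; have [_ [z Fz] _] := FI.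
  by have [t _ e] := Fl z Fz; rewrite x0 scaler0; rewrite x0 scaler0 in e; rewrite e.
have [i xi] : exists i, x 0 i != 0.
  by have /rV0Pn := x0.
move: nF => /existsNP[_ /not_implyP[[s _ <-] nFs]].
have [[S FE] _ _] := FI.
have /existsNP[p /not_implyP[Sp ps]] : ~ zero_locus S (s *: x) by rewrite -FE.
have [q qE] := line_pullback x p.
have q0 : lead_coef q != 0.
  by rewrite lead_coef_eq0; apply: contra_not_neq ps => q0; rewrite -qE q0 horner0.
have [r qr] := closed_field_poly_normal q.
(* This linear form recovers the parameter on the line. *)
have coordE t : ((x 0 i)^-1 *: 'X_i : {mpoly K[k]}).@[(t *: x) 0] = t.
  by rewrite mevalZ mevalXU mxE mulrCA mulVf // mulr1.
pose l (a : K) : {mpoly K[k]} := (x 0 i)^-1 *: 'X_i - a%:MP.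
have lE a t : (l a).@[(t *: x) 0] = t - a by rewrite mevalB coordE mevalC.
have [|a aP] := irreducible_closed_prod (s := r) (p := l) FI.
  move=> y Fy; have [t _ ty] := Fl y Fy.
  have : q.[t] = 0 by rewrite qE ty; move: Fy; rewrite FE => /(_ p Sp).
  rewrite qr hornerZ => /eqP; rewrite mulf_eq0 (negPf q0) /= horner_prod => /eqP <-.
  rewrite -ty rmorph_prod; apply: eq_bigr => a _.
  by rewrite /= lE hornerXsubC.
exists (a *: x) => y Fy; have [t _ ty] := Fl y Fy.
by have := aP y Fy; rewrite -ty lE => /subr0_eq ->.
Qed.

(** The origin and the line form a chain of length 1. In a longer chain the second member would be
    proper in the line, hence a point, and could not strictly contain the first. *)
Lemma affine_dim_line (K : numClosedFieldType) k (x : 'rV[K]_k) : x != 0 ->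
  zariski_closed [set s *: x | s in [set: K]] ->
  affine_dim [set s *: x | s in [set: K]] = 1%N.
Proof.
move=> x0 lC; set V := (X in affine_dim X).
have VI : irreducible_closed V by apply: irreducible_line.
have dim1 : is_dim V 1.
  split; last first.
    move=> e [F [FI FS]]; rewrite leqNgt; apply/negP => e1.
    have [F0I _] := FI 0%N isT.
    have [F1I _] := FI 1%N (ltnW e1).
    have [_ F2V] := FI 2%N e1.
    have [F01 nF10] := FS 0%N (ltnW e1).
    have [|y F1y] := proper_irreducible_line (x := x) F1I.
      have [F12 nF21] := FS 1%N e1; split; first exact: subset_trans F12 F2V.
      by move=> VF; apply: nF21; apply: subset_trans F2V VF.
    apply: nF10 => z /F1y ->.
    by have [_ [w F0w] _] := F0I; rewrite -(F1y w (F01 w F0w)).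
  exists (fun i => if i is 0%N then [set 0] else V); split => [[|i] _|[|i] //= _].
  - split; last by move=> _ ->; exists 0; rewrite ?scale0r.
    split; [|by exists 0|].
    + exists [set p | exists i, p = 'X_i]; apply/seteqP; split => [_ -> _ [i ->]|y yP].
        by rewrite mevalXU mxE.
      by apply/rowP => i; have := yP 'X_i; rewrite mevalXU mxE; apply; exists i.
    + move=> A B _ _ AB; have [] := AB 0 erefl => H; [left|right];
      by move=> _ ->.
  - by split.
  - split; first by move=> _ ->; exists 0; rewrite ?scale0r.
    move=> /(_ x) H; move/eqP: x0; apply; apply: H.
    by exists 1; rewrite ?scale1r.
apply: xget_unique => // d [[F dF] dmax]; apply/eqP; rewrite eqn_leq.
have [[G dG] max1] := dim1.
by rewrite (max1 d) ?(dmax 1%N) //; [exists G | exists F].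
Qed.

(** * Tensors *)

Lemma prod_mpolyX (K : comNzRingType) n (s : seq 'I_n) :
  \prod_(j <- s) 'X_j = 'X_[\sum_(j <- s) U_(j)] :> {mpoly K[n]}.
Proof.
elim: s => [|j s IH]; first by rewrite !big_nil mpolyX0.
by rewrite !big_cons IH mpolyXD.
Qed.

(** Entries whose trailing indices are permutations of each other contribute to the same
    coefficient. *)
Lemma tensor_form_coef (K : comNzRingType) n m (T : tensor K n m) (c : coef_index n m.-1) :
  form_coef (tensor_form T) c = \sum_(J : m.-tuple 'I_n | ohead J == Some c.1)
    T J * ((\sum_(j <- behead J) U_(j))%MM == val (val c.2))%:R.
Proof.
rewrite /form_coef /tensor_form raddf_sum; apply: eq_bigr => J _ /=.
by rewrite mcoeffZ prod_mpolyX mcoeffX.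
Qed.

Lemma rmorph_tensor_form_coef (K L : comNzRingType) (f : {rmorphism K -> L}) n m
    (T : tensor K n m) (T' : tensor L n m) (c : coef_index n m.-1) :
  (forall J, f (T J) = T' J) -> f (form_coef (tensor_form T) c) = form_coef (tensor_form T') c.
Proof.
move=> fT; rewrite !tensor_form_coef rmorph_sum; apply: eq_bigr => J _.
by rewrite rmorphM fT rmorph_nat.
Qed.

Lemma tensor_form_identity (K : comNzRingType) n m i : (0 < m)%N ->
  tensor_form (identity_tensor K n m) i = 'X_i ^+ m.-1.
Proof.
case: m => // m _; rewrite /tensor_form (bigD1 [tuple of nseq m.+1 i]) //=.
have cst : constant (nseq m.+1 i) by apply: constant_nseq.
rewrite ffunE cst scale1r /= big_nseq -[RHS]mulr1 iter_mulr big1 ?addr0 ?mulr1 // => J.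
move=> /andP[/eqP Ji]; case: J Ji => -[|j s] // sz /= [ji]; rewrite ji in sz *.
rewrite ffunE /=; case: allP => [sP|]; last by rewrite scale0r.
case/eqP; apply: val_inj => /=; congr (_ :: _).
by move: sz; rewrite eqSS => /eqP <-; exact/all_pred1P/allP.
Qed.

(** * The characteristic polynomial as a specialization *)

Definition identity_coef n m (c : coef_index n m.-1) : int :=
  form_coef (tensor_form (identity_tensor int n m)) c.

Lemma identity_coefE (K : comNzRingType) n m (c : coef_index n m.-1) :
  (identity_coef c)%:~R = form_coef (tensor_form (identity_tensor K n m)) c.
Proof. by apply: rmorph_tensor_form_coef => J; rewrite !ffunE rmorph_nat. Qed.

Lemma char_tensor_coef (K : fieldType) n m (T : tensor K n m) (c : coef_index n m.-1) :
  form_coef (tensor_form (char_tensor T)) c =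
  'X * (identity_coef c)%:~R - (form_coef (tensor_form T) c)%:P.
Proof.
rewrite identity_coefE !tensor_form_coef rmorph_sum mulr_sumr -sumrB.
by apply: eq_bigr => J _; rewrite !ffunE rmorphM mulrA mulrBl rmorph_nat.
Qed.

(** The generic characteristic polynomial. Its indeterminates are the coefficients of the forms, not
    the tensor entries, because [Res] is irreducible as a polynomial in the former. *)
Definition pencil n m (Res : {mpoly int[#|coef_index n m.-1|]}) :
    {poly {mpoly int[#|coef_index n m.-1|]}} :=
  mmap intr (fun k => 'X * (identity_coef (enum_val k))%:~R - ('X_k)%:P) Res.

Lemma tensor_charpolyE (K : fieldType) n m (Res : {mpoly int[#|coef_index n m.-1|]})
    (T : tensor K n m) :
  tensor_charpoly Res T = map_poly
    (mmap (intr : int -> K) (fun k => form_coef (tensor_form T) (enum_val k))) (pencil Res).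
Proof.
apply/esym/mmap_int_comp => k /=.
by rewrite char_tensor_coef rmorphB rmorphM rmorph_int /= map_polyX map_polyC /= mmap_intX.
Qed.

Lemma tensor_charpoly_eval (K : fieldType) n m (Res : {mpoly int[#|coef_index n m.-1|]})
    (T : tensor K n m) (l : K) : (0 < m)%N ->
  (tensor_charpoly Res T).[l] =
  eval_at_forms Res (fun i => l *: 'X_i ^+ m.-1 - tensor_form T i).
Proof.
move=> m0; apply: (mmap_int_comp (f := horner_eval l)) => k /=.
rewrite char_tensor_coef /horner_eval -(rmorph_int (@polyC K)) !hornerE.
by rewrite [RHS]/form_coef mcoeffB mcoeffZ -tensor_form_identity // identity_coefE.
Qed.

Lemma mnm_seq n (a : 'X_{1..n}) : exists2 s : seq 'I_n,
  size s = mdeg a & (\sum_(j <- s) U_(j))%MM = a.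
Proof.
pose s := flatten [seq nseq (a i) i | i <- enum 'I_n].
have sa : (\sum_(j <- s) U_(j))%MM = a.
  rewrite [RHS]multinomUE_id big_flatten big_map big_enum; apply: eq_bigr => i _.
  by rewrite big_nseq; elim: (a i) => // k IH; rewrite iterS IH mulmS.
exists s => //; rewrite -[in RHS]sa mdeg_sum -sum1_size.
by apply: eq_bigr => j _; rewrite mdeg1.
Qed.

(** For each coefficient choose one tuple that spells its form and monomial, put the value there and
    0 elsewhere. Distinct coefficients get distinct tuples. *)
Lemma tensor_form_surj (K : fieldType) n m (v : coef_index n m.-1 -> K) : (0 < m)%N ->
  exists T : tensor K n m, forall c, form_coef (tensor_form T) c = v c.
Proof.
move=> m0.
have /choice[Jof JP] (c : coef_index n m.-1) : exists J : m.-tuple 'I_n,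
    ohead J = Some c.1 /\ (\sum_(j <- behead J) U_(j))%MM = val (val c.2).
  case: c => i a; have [s sz sa] := mnm_seq (val (val a)).
  have szJ : size (i :: s) == m by rewrite /= sz (eqP (valP a)) prednK.
  by exists (Tuple szJ).
exists [ffun J => if [pick c | Jof c == J] is Some c then v c else 0] => c.
have [J1 J2] := JP c.
rewrite tensor_form_coef (bigD1 (Jof c)) /=; last by rewrite J1.
have inj c' : ohead (Jof c') = Some c.1 ->
    (\sum_(j <- behead (Jof c')) U_(j))%MM = val (val c.2) -> c' = c.
  have [-> ->] := JP c'; case: c c' {J1 J2} => i a [i' a'] /= [->] e.
  by congr (_, _); do 2 apply: val_inj.
rewrite ffunE J2 eqxx mulr1; case: pickP => [c' /eqP e|/(_ c)]; last by rewrite eqxx.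
rewrite (inj c') ?e // big1 ?addr0 // => J /andP[/eqP hJ JJ]; rewrite ffunE.
case: pickP => [c2 /eqP e2|]; last by rewrite mul0r.
case: eqP => [sJ|]; last by rewrite mulr0.
by case/eqP: JJ; rewrite -e2; congr Jof; apply: inj; rewrite e2.
Qed.

(** * Two independent eigenvectors force a double root *)

Lemma separating_linear_form (K : fieldType) n (x y : 'rV[K]_n) :
  x != 0 -> ~ (exists s, y = s *: x) ->
  exists2 l : {mpoly K[n]}, l \is 1.-homog & l.@[x 0] = 1 /\ l.@[y 0] = 0.
Proof.
move=> /rV0Pn[i xi] nxy.
(* If all these minors vanished, [y] would be y_i / x_i times [x]. *)
have [j nj] : exists j, x 0 i * y 0 j - x 0 j * y 0 i != 0.
  apply: contrapT => /forallNP H; apply: nxy; exists (y 0 i / x 0 i).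
  apply/rowP => j; rewrite mxE; have /negP/negPn := H j; rewrite subr_eq0 => /eqP e.
  by apply: (mulfI xi); rewrite e; field.
exists ((x 0 i * y 0 j - x 0 j * y 0 i)^-1 *: (y 0 j *: 'X_i - y 0 i *: 'X_j)).
  by apply: rpredZ; apply: rpredB; apply: rpredZ; rewrite dhomogX /= mdeg1.
rewrite !mevalZ !mevalB !mevalZ !mevalXU; split.
  by rewrite [y 0 j * _]mulrC [y 0 i * _]mulrC mulVf.
by rewrite mulrC [y 0 i * _]mulrC subrr mul0r.
Qed.

(* If x and y were independent solutions of f = 0, the diagonal form system
   splits as g + h with g x = 0 and h y = 0; then Res (f + (s - l) g + (t - l) h)
   vanishes for t = l and for s = l, so it is divisible by (s - l)(t - l), and
   on the diagonal s = t it is the characteristic polynomial. *)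
Lemma independent_eigenvectors_double_root (K : numFieldType) n m
    (Res : {mpoly int[#|coef_index n m.-1|]}) (T : tensor K n m) (l : K) (x y : 'rV[K]_n) :
  (1 < m)%N -> is_resultant K Res -> x != 0 -> y != 0 -> ~ (exists s, y = s *: x) ->
  tensor_apply T x = l *: hadamard_exp x m.-1 ->
  tensor_apply T y = l *: hadamard_exp y m.-1 ->
  ('X - l%:P) ^+ 2 %| tensor_charpoly Res T.
Proof.
move=> m1 [_ Res0 _] x0 y0 nxy ex ey.
have m0 : (0 < m)%N by exact: ltnW.
have [L Lh [Lx Ly]] := separating_linear_form x0 nxy.
pose d := m.-1.
(* Positivity of [d] makes [L ^+ d] vanish at [y]. *)
have d0 : (0 < d)%N by rewrite /d; case: m m1 {ex ey Res Res0 T m0 d} => [|[]].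
pose f i : {mpoly K[n]} := l *: 'X_i ^+ d - tensor_form T i.
(* [h] agrees with the diagonal system at [x] and vanishes at [y]. *)
pose h i : {mpoly K[n]} := x 0 i ^+ d *: L ^+ d.
pose g i : {mpoly K[n]} := 'X_i ^+ d - h i.
have hx i : (h i).@[x 0] = x 0 i ^+ d by rewrite mevalZ rmorphXn /= Lx expr1n mulr1.
have hy i : (h i).@[y 0] = 0 by rewrite mevalZ rmorphXn /= Ly expr0n gtn_eqF // mulr0.
have hd i : h i \is d.-homog by apply: rpredZ; have := dhomogMn d Lh; rewrite mul1n.
have Xd i : 'X_i ^+ d \is [in K[n], d.-homog].
  have X1 : ('X_i : {mpoly K[n]}) \is 1.-homog by rewrite dhomogX /= mdeg1.
  by have := dhomogMn d X1; rewrite mul1n.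
have gd i : g i \is d.-homog by rewrite /g; apply: rpredB; [exact: Xd | exact: hd].
have fd i : f i \is d.-homog.
  by rewrite /f; apply: rpredB; [apply: rpredZ; exact: Xd | exact: tensor_form_homog].
have evX (z : 'rV[K]_n) i : ('X_i ^+ d : {mpoly K[n]}).@[z 0] = z 0 i ^+ d.
  by rewrite rmorphXn /= mevalXU.
have fz (z : 'rV[K]_n) i : tensor_apply T z = l *: hadamard_exp z d -> (f i).@[z 0] = 0.
  by move=> ez; rewrite mevalB mevalZ evX tensor_formE ez !mxE subrr.
have gx i : (g i).@[x 0] = 0 by rewrite mevalB evX hx subrr.
pose N := #|coef_index n d|.
pose cf (F : 'I_n -> {mpoly K[n]}) (k : 'I_N) : K := form_coef F (enum_val k).
(* The inner variable is s and the outer one is t. *)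
pose v k : {poly {poly K}} := (cf f k)%:P%:P
  + ('X%:P - l%:P%:P) * (cf g k)%:P%:P + ('X - l%:P%:P) * (cf h k)%:P%:P.
pose Q := mmap (intr : int -> {poly {poly K}}) v Res.
have Qt : Q.[l%:P] = 0.
  have -> : Q.[l%:P] = mmap (intr : int -> {poly K})
      (fun k => (cf f k)%:P + ('X - l%:P) * (cf g k)%:P) Res.
    apply: (mmap_int_comp (f := horner_eval l%:P)) => k.
    by rewrite /= /v /horner_eval !hornerE; ring.
  apply: poly_eval0 => s; rewrite -[LHS]/(horner_eval s _).
  transitivity (eval_at_forms Res (fun i => f i + (s - l) *: g i)).
    apply: (mmap_int_comp (f := horner_eval s)) => k; rewrite /= /horner_eval !hornerE.
    by rewrite /form_coef mcoeffD mcoeffZ.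
  apply/Res0; first by move=> i; apply: rpredD; [exact: fd | apply: rpredZ; exact: gd].
  by exists x => // i; rewrite mevalD mevalZ (fz x) // gx mulr0 addr0.
have Qs : map_poly (horner_eval l) Q = 0.
  have -> : map_poly (horner_eval l) Q = mmap (intr : int -> {poly K})
      (fun k => (cf f k)%:P + ('X - l%:P) * (cf h k)%:P) Res.
    apply: (mmap_int_comp (f := map_poly (horner_eval l))) => k.
    rewrite /v !(rmorphD, rmorphN, rmorphM) /= !map_polyC map_polyX /= /horner_eval.
    by rewrite !hornerE subrr mul0r addr0.
  apply: poly_eval0 => s; rewrite -[LHS]/(horner_eval s _).
  transitivity (eval_at_forms Res (fun i => f i + (s - l) *: h i)).
    apply: (mmap_int_comp (f := horner_eval s)) => k; rewrite /= /horner_eval !hornerE.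
    by rewrite /form_coef mcoeffD mcoeffZ.
  apply/Res0; first by move=> i; apply: rpredD; [exact: fd | apply: rpredZ; exact: hd].
  by exists y => // i; rewrite mevalD mevalZ (fz y) // hy mulr0 addr0.
(* On the diagonal s = t = X, as g + h is the diagonal system, the argument becomes X I - T. *)
have QX : Q.['X] = tensor_charpoly Res T.
  apply: (mmap_int_comp (f := horner_eval 'X)) => k.
  rewrite char_tensor_coef -(rmorph_int (@polyC K)) identity_coefE.
  set I := form_coef (tensor_form (identity_tensor _ _ _)) _.
  have fk : cf f k = l * I - form_coef (tensor_form T) (enum_val k).
    by rewrite /I /cf /form_coef tensor_form_identity // mcoeffB mcoeffZ.
  have gk : cf g k = I - cf h k.
    by rewrite /I /cf /form_coef tensor_form_identity // mcoeffB.
  by rewrite /= /v /horner_eval !hornerE fk gk !polyCB polyCM; ring.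
have /factor_theorem[Q1 eQ] : root Q l%:P by apply/eqP.
(* At s = l the product of [Q1] and t - l is zero; t - l is not, so [Q1] vanishes there, which gives
   the second factor on the diagonal. *)
have Q1l : root Q1.['X] l.
  have : map_poly (horner_eval l) Q1 = 0.
    move/eqP: Qs; rewrite eQ rmorphM /= mulf_eq0 => /orP[/eqP //|].
    rewrite rmorphB /= map_polyX map_polyC /= /horner_eval hornerC.
    by rewrite polyXsubC_eq0.
  move=> e; apply/eqP; rewrite -[LHS]/(horner_eval l _) -horner_map /= e.
  exact: horner0.
have /factor_theorem[Q2 eQ2] := Q1l.
rewrite -QX eQ hornerM hornerXsubC eQ2 -mulrA -expr2.
exact: dvdp_mulIr.
Qed.

(** * Homogeneity and closedness of eigenvarieties *)

Lemma tensor_applyZ (K : comNzRingType) n m (T : tensor K n m) (s : K) (x : 'rV[K]_n) :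
  tensor_apply T (s *: x) = s ^+ m.-1 *: tensor_apply T x.
Proof.
apply/rowP => i; rewrite !mxE mulr_sumr; apply: eq_bigr => J _.
rewrite mulrCA; congr (_ * _).
have -> : m.-1 = size (behead J) by rewrite size_behead size_tuple.
elim: (behead J) => [|j r IH]; first by rewrite !big_nil mulr1.
by rewrite !big_cons IH mxE /= exprS mulrACA.
Qed.

Lemma hadamard_expZ (K : comNzRingType) n (e : nat) (s : K) (x : 'rV[K]_n) :
  hadamard_exp (s *: x) e = s ^+ e *: hadamard_exp x e.
Proof. by apply/rowP => i; rewrite !mxE exprMn. Qed.

Lemma eigenvariety_closed (K : fieldType) n m (T : tensor K n m) (l : K) : (0 < m)%N ->
  zariski_closed (eigenvariety T l).
Proof.
move=> m0; exists [set p | exists i, p = l *: 'X_i ^+ m.-1 - tensor_form T i].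
have pE (x : 'rV[K]_n) i : (l *: 'X_i ^+ m.-1 - tensor_form T i).@[x 0] =
    (l *: hadamard_exp x m.-1) 0 i - tensor_apply T x 0 i.
  by rewrite mevalB mevalZ rmorphXn /= mevalXU tensor_formE !mxE.
apply/seteqP; split => x /=.
  by move=> e _ [i ->]; rewrite pE e subrr.
by move=> H; apply/rowP => i; apply/esym/subr0_eq; rewrite -pE; apply: H; exists i.
Qed.

Lemma eigenvariety_line (K : fieldType) n m (T : tensor K n m) (l : K) (x : 'rV[K]_n) :
  eigenvariety T l x -> (forall y, y != 0 -> eigenvariety T l y -> exists s, y = s *: x) ->
  eigenvariety T l = [set s *: x | s in [set: K]].
Proof.
move=> ex ey; apply/seteqP; split => [y Ty|_ [s _ <-]].
  have [->|y0] := eqVneq y 0; first by exists 0; rewrite ?scale0r.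
  by have [s ->] := ey y y0 Ty; exists s.
by rewrite /eigenvariety /= tensor_applyZ ex hadamard_expZ !scalerA mulrC.
Qed.

Lemma eigenvalue_charpoly_root (K : fieldType) n m (Res : {mpoly int[#|coef_index n m.-1|]})
    (T : tensor K n m) (l : K) :
  (0 < m)%N -> is_resultant K Res -> spectrum T l -> root (tensor_charpoly Res T) l.
Proof.
move=> m0 [_ Res0 _] [x x0 ex]; apply/eqP; rewrite tensor_charpoly_eval //; apply/Res0.
  move=> i; apply: rpredB; last exact: tensor_form_homog.
  by rewrite -tensor_form_identity //; apply: rpredZ; exact: tensor_form_homog.
exists x => // i; rewrite mevalB mevalZ rmorphXn /= mevalXU tensor_formE ex !mxE.
by rewrite subrr.
Qed.

(** * Generic simplicity of the eigenvalues *)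

(** The characteristic polynomial of the zero tensor is 0 at 0, where every nonzero vector is an
    eigenvector, and 1 at 1 by the normalization of [Res], so the pencil is not constant. *)
Lemma size_pencil (K : fieldType) n m (Res : {mpoly int[#|coef_index n m.-1|]}) :
  (0 < m)%N -> (0 < n)%N -> is_resultant K Res -> (1 < size (pencil Res))%N.
Proof.
move=> m0 n0 hR; have [_ _ Res1] := hR; rewrite ltnNge; apply/negP => sz.
pose T : tensor K n m := [ffun _ => 0].
have T0 i : tensor_form T i = 0.
  by apply: big1 => J _; rewrite ffunE scale0r.
have c01 : (tensor_charpoly Res T).[0] = (tensor_charpoly Res T).[1].
  by rewrite tensor_charpolyE (size1_polyC sz) map_polyC !hornerC.
have e0 : (tensor_charpoly Res T).[0] = 0.
  apply/eqP/(eigenvalue_charpoly_root m0 hR); exists (const_mx 1).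
    by apply/rV0Pn; exists (Ordinal n0); rewrite mxE oner_neq0.
  by apply/rowP => i; rewrite -tensor_formE T0 meval0 !mxE mul0r.
move: c01; rewrite e0 tensor_charpoly_eval // => /esym/eqP; apply/negP.
have -> : eval_at_forms Res (fun i => 1 *: 'X_i ^+ m.-1 - tensor_form T i) =
    (eval_at_forms Res (fun i => 'X_i ^+ m.-1 : {mpoly int[n]}))%:~R.
  apply/esym/(mmap_int_comp (f := intr)) => k.
  rewrite /form_coef T0 subr0 scale1r -!tensor_form_identity //.
  exact: identity_coefE.
by rewrite Res1 oner_neq0.
Qed.

(** A double root is also a root of the derivative, so evaluating the relation there would give a =
    0. *)
Lemma charpoly_simple_root (K : fieldType) (p u v : {poly K}) (a l : K) :
  a != 0 -> u * p + v * p^`() = a%:P -> ~~ (('X - l%:P) ^+ 2 %| p).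
Proof.
move=> a0 e; apply/negP => /dvdpP[q pq].
move: a0; rewrite -[a](hornerC _ l) -e pq exprS expr1 mulrA !derivM !derivXsubC.
by rewrite !(hornerXsubC, hornerD, hornerM) subrr !(mulr0, mul0r, addr0) eqxx.
Qed.

(** The polynomial [D] is [a] pulled back along the linear map from tensor entries to form
    coefficients. Its nonvanishing set is nonempty because that map is onto and [a] has a
    non-root. *)
Lemma generically_nonzero (K : numFieldType) n m (a : {mpoly int[#|coef_index n m.-1|]}) :
  (0 < m)%N -> a != 0 ->
  generically (fun T : tensor K n m =>
    mmap (intr : int -> K) (fun k => form_coef (tensor_form T) (enum_val k)) a != 0).
Proof.
move=> m0 a0; pose M := #|{: m.-tuple 'I_n}|.
pose G : tensor {mpoly K[M]} n m := [ffun J => 'X_(enum_rank J)].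
pose D := mmap (intr : int -> {mpoly K[M]}) (fun k => form_coef (tensor_form G) (enum_val k)) a.
have DE (T : tensor K n m) : D.@[tensor_coords T 0] =
    mmap (intr : int -> K) (fun k => form_coef (tensor_form T) (enum_val k)) a.
  apply: (mmap_int_comp (f := meval (tensor_coords T 0))) => k.
  by apply: rmorph_tensor_form_coef => J; rewrite /= ffunE mevalXU mxE enum_rankK.
exists [set t | D.@[t 0] != 0]; split.
- exists [set D]; apply/seteqP; split => t /=; first by move=> /negP/negPn/eqP H _ ->.
  by move=> /(_ D erefl) ->; rewrite eqxx.
- have [v v0] := mpoly_int_nonroot K a0.
  have [T TE] := tensor_form_surj (fun c => v (enum_rank c)) m0.
  exists (tensor_coords T); rewrite /= DE; apply: contra_neq v0 => <-.
  by congr mmap; apply: funext => k; rewrite TE enum_valK.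
- by move=> T; rewrite /= DE.
Qed.

Theorem theorem6p4 (R : realType) (m n : nat) (hm : (2 <= m)%N) (hn : (1 <= n)%N)
    (Res : {mpoly int[#|coef_index n m.-1|]})
    (hRes : is_resultant R[i] Res) :
  generically (fun T : tensor R[i] n m =>
    forall lambda : R[i], spectrum T lambda ->
      alg_mult Res T lambda = 1%N /\ geom_mult T lambda = 1%N).
Proof.
have m0 : (0 < m)%N by exact: ltnW.
have [irr _ _] := hRes.
have Rp := prime_pencil (fun k => @identity_coef n m (enum_val k))
  (irreducible_prime (@factorial_mpoly_int _) irr).
have [a [u [v [a0 e]]]] := prime_deriv_bezout Rp (size_pencil m0 hn hRes).
have [U [Uo U0 UP]] := generically_nonzero R[i] m0 a0.
exists U; split => // T /UP + l lT.
pose ev : {rmorphism {mpoly int[#|coef_index n m.-1|]} -> R[i]} :=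
  mmap intr (fun k => form_coef (tensor_form T) (enum_val k)).
rewrite -[mmap _ _ _]/(ev a) => aT.
have eT : map_poly ev u * tensor_charpoly Res T +
    map_poly ev v * (tensor_charpoly Res T)^`() = (ev a)%:P.
  by rewrite tensor_charpolyE deriv_map -!rmorphM -rmorphD e /= map_polyC.
(* The divisibility bounds on [mup] hold for nonzero polynomials. *)
have chi0 : tensor_charpoly Res T != 0.
  apply: contra_neq aT => z; apply/eqP; rewrite -polyC_eq0 -eT z.
  by rewrite deriv0 !mulr0 addr0.
have rl := eigenvalue_charpoly_root m0 hRes lT.
have ndvd := charpoly_simple_root l aT eT.
split.
  apply/eqP; rewrite eqn_leq /alg_mult mup_leq // ndvd mup_geq // expr1.
  by rewrite -root_factor_theorem.
have [x x0 ex] := lT.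
have lineE : eigenvariety T l = [set s *: x | s in [set: R[i]]].
  apply: eigenvariety_line => // y y0 ey; apply: contrapT => nxy; case/negP: ndvd.
  exact: (independent_eigenvectors_double_root hm hRes x0 y0 nxy).
(* The line is closed because it is the eigenvariety. *)
rewrite /geom_mult lineE affine_dim_line // -lineE.
exact: eigenvariety_closed.
Qed.
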